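(* Let $G$ be a $2n$-dimensional Lie group with Lie algebra $\mathfrak{g}$ and left-invariant almost Hermitian structure $(\langle\cdot,\cdot\rangle,J,\omega)$, let $e_1,\dots,e_{2n}$ be a standard frame, and let $C^c_{ab}:=\langle[e_a,e_b],e_c\rangle$. Let $\alpha\in\wedge^{(1,1)}\mathfrak{g}^\ast\otimes\mathfrak{g}$, $\alpha^c_{ab}:=\langle\alpha(e_a,e_b),e_c\rangle$, and let $T^\alpha$ be the torsion of the left-invariant Hermitian connection $\nabla^\alpha$ associated to $\alpha$. Then for $1\le i,j,k\le n$: $$\begin{aligned}\langle T^\alpha(e_i,e_j),e_k\rangle&=-\tfrac12C^k_{ij}-\tfrac14C^j_{ik}+\tfrac14C^i_{jk}+\tfrac12C^k_{n+i,n+j}+\tfrac14C^i_{n+j,n+k}+\tfrac14C^j_{n+k,n+i}+\tfrac14C^{n+i}_{j,n+k}\\&\quad+\tfrac14C^{n+j}_{n+k,i}+\tfrac14C^{n+i}_{k,n+j}-\tfrac14C^{n+j}_{k,n+i}+\alpha^k_{ij}+\tfrac12\alpha^i_{jk}+\tfrac12\alpha^j_{ki}-\tfrac12\alpha^{n+i}_{n+j,k}-\tfrac12\alpha^{n+j}_{k,n+i},\end{aligned}$$ $$\begin{aligned}\langle T^\alpha(e_i,e_j),e_{n+k}\rangle&=-\tfrac12C^{n+k}_{ij}+\tfrac12C^{n+k}_{n+i,n+j}-\tfrac14C^j_{k,n+i}-\tfrac14C^i_{n+j,k}-\tfrac14C^j_{i,n+k}+\tfrac14C^{n+i}_{n+k,n+j}+\tfrac14C^i_{j,n+k}\\&\quad-\tfrac14C^{n+j}_{n+k,n+i}-\tfrac14C^{n+j}_{ki}-\tfrac14C^{n+i}_{jk}+\alpha^{n+k}_{ij}+\tfrac12\alpha^i_{j,n+k}+\tfrac12\alpha^j_{n+k,i}-\tfrac12\alpha^{n+i}_{n+j,n+k}-\tfrac12\alpha^{n+j}_{n+k,n+i},\end{aligned}$$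 $$\begin{aligned}\langle T^\alpha(e_i,e_{n+j}),e_k\rangle&=-\tfrac12C^k_{n+i,j}-\tfrac12C^k_{i,n+j}-\tfrac14C^{n+j}_{n+i,n+k}+\tfrac14C^i_{n+k,j}+\tfrac14C^{n+i}_{n+j,n+k}-\tfrac14C^j_{n+k,i}-\tfrac14C^i_{k,n+j}\\&\quad-\tfrac14C^j_{n+i,k}-\tfrac14C^{n+j}_{ik}-\tfrac14C^{n+i}_{kj}+\alpha^k_{i,n+j}+\tfrac12\alpha^i_{n+j,k}+\tfrac12\alpha^{n+j}_{ki}+\tfrac12\alpha^{n+i}_{jk}+\tfrac12\alpha^j_{k,n+i},\end{aligned}$$ $$\begin{aligned}\langle T^\alpha(e_i,e_{n+j}),e_{n+k}\rangle&=-\tfrac12C^{n+k}_{n+i,j}-\tfrac12C^{n+k}_{i,n+j}+\tfrac14C^i_{jk}-\tfrac14C^{n+j}_{k,n+i}+\tfrac14C^i_{n+j,n+k}+\tfrac14C^j_{n+k,n+i}+\tfrac14C^j_{ki}\\&\quad-\tfrac14C^{n+i}_{n+j,k}-\tfrac14C^{n+j}_{i,n+k}-\tfrac14C^{n+i}_{n+k,j}+\alpha^{n+k}_{i,n+j}+\tfrac12\alpha^i_{n+j,n+k}+\tfrac12\alpha^{n+j}_{n+k,i}+\tfrac12\alpha^{n+i}_{j,n+k}+\tfrac12\alpha^j_{n+k,n+i},\end{aligned}$$ $$\begin{aligned}\langle T^\alpha(e_{n+i},e_{n+j}),e_k\rangle&=-\tfrac12C^k_{n+i,n+j}+\tfrac12C^k_{ij}-\tfrac14C^i_{n+j,n+k}-\tfrac14C^j_{n+k,n+i}-\tfrac14C^{n+i}_{j,n+k}-\tfrac14C^{n+j}_{n+k,i}-\tfrac14C^{n+i}_{k,n+j}\\&\quad+\tfrac14C^j_{ik}+\tfrac14C^i_{kj}+\tfrac14C^{n+j}_{k,n+i}+\alpha^k_{n+i,n+j}+\tfrac12\alpha^j_{n+i,n+k}+\tfrac12\alpha^{n+i}_{n+k,j}+\tfrac12\alpha^{n+j}_{i,n+k}+\tfrac12\alpha^i_{n+k,n+j},\end{aligned}$$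 $$\begin{aligned}\langle T^\alpha(e_{n+i},e_{n+j}),e_{n+k}\rangle&=-\tfrac12C^{n+k}_{n+i,n+j}+\tfrac12C^{n+k}_{ij}+\tfrac14C^i_{n+j,k}+\tfrac14C^j_{k,n+i}+\tfrac14C^{n+i}_{jk}+\tfrac14C^{n+j}_{ki}+\tfrac14C^{n+i}_{n+j,n+k}\\&\quad-\tfrac14C^j_{n+k,i}-\tfrac14C^i_{j,n+k}+\tfrac14C^{n+j}_{n+k,n+i}+\alpha^{n+k}_{n+i,n+j}+\tfrac12\alpha^{n+i}_{n+j,n+k}+\tfrac12\alpha^{n+j}_{n+k,n+i}-\tfrac12\alpha^i_{j,n+k}-\tfrac12\alpha^j_{n+k,i}.\end{aligned}$$
   Context: $\mathfrak{g}$ is the space of left-invariant vector fields on $G$. A left-invariant almost Hermitian structure consists of a left-invariant Riemannian metric $\langle\cdot,\cdot\rangle$, a left-invariant almost complex structure $J$ orthogonal for the metric, and $\omega(X,Y)=\langle JX,Y\rangle$. A standard frame is an orthonormal frame of left-invariant vector fields $e_1,\dots,e_n,e_{n+1},\dots,e_{2n}$ with $Je_i=e_{n+i}$ for $1\le i\le n$. $\wedge^{(1,1)}\mathfrak{g}^\ast\otimes\mathfrak{g}$ is the space of real left-invariant $\mathfrak{g}$-valued 2-forms $\alpha$ with $\alpha(JX,JY)=\alpha(X,Y)$. A connection is Hermitian if it preserves both the metric and $J$; the torsion is $T(X,Y)=\nabla_XY-\nabla_YX-[X,Y]$. The Hermitian connection $\nabla^\alpha$ associated to $\alpha$ is the (unique)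 metric-compatible connection whose torsion $T^\alpha$ is $$\begin{aligned}\langle T^\alpha(X,Y),Z\rangle&=-\tfrac14\langle N(X,Y),Z\rangle-\tfrac12(d\omega)^+(JX,JY,JZ)+\tfrac12(d\omega)^+(X,Y,JZ)\\&\quad+\tfrac12\alpha^+(X,Y,Z)-\tfrac12\alpha^+(JX,JY,Z)+\langle\alpha(X,Y),Z\rangle,\end{aligned}$$ where $N(X,Y):=J[JX,Y]+J[X,JY]+[X,Y]-[JX,JY]$; $\alpha^+(X,Y,Z):=\langle\alpha(X,Y),Z\rangle+\langle\alpha(Y,Z),X\rangle+\langle\alpha(Z,X),Y\rangle$; for a real 3-form $\eta$, $\eta^+$ is its $(2,1)+(1,2)$-part, $\eta^+(X,Y,Z)=\frac14[3\eta(X,Y,Z)+\eta(JX,JY,Z)+\eta(JX,Y,JZ)+\eta(X,JY,JZ)]$; and $d\omega(X,Y,Z)=-\omega([X,Y],Z)-\omega([Y,Z],X)-\omega([Z,X],Y)$ for left-invariant $X,Y,Z$. *)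

(* Defs.v *)
From HB Require Import structures.
From mathcomp Require Import all_boot all_order all_algebra.
From mathcomp Require Import reals.
From mathcomp Require Import ring lra.

Set Implicit Arguments.
Unset Strict Implicit.
Unset Printing Implicit Defensive.

Import GRing.Theory Num.Theory.
Local Open Scope ring_scope.

(* Left-invariant tensors on a Lie group [G] are tensors on its Lie algebra
   [g]: a left-invariant metric is an inner product on [g], a left-invariant
   connection is a bilinear map [(X, Y) |-> nabla_X Y] on [g], and so on. *)

Section LeftInvariantGeometry.

Context {R : realType} {g : vectType R}.

Definition alternating {V : zmodType} (f : g -> g -> V) :=
  forall X, f X X = 0.

Definition lie_bracket (br : {bilinear g -> g -> g}) :=
  alternating br /\
  (forall X Y Z, br X (br Y Z) + br Y (br Z X) + br Z (br X Y) = 0).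

Definition almost_hermitian (ip : {dot g for @idfun R}) (J : {linear g -> g}) :=
  (forall X, J (J X) = - X) /\ (forall X Y, ip (J X) (J Y) = ip X Y).

(* The index [lshift n i] has value [i], and [rshift n i] has value [n + i]. *)
Definition standard_frame (ip : {dot g for @idfun R}) (J : {linear g -> g})
    (n : nat) (e : 'I_(n + n) -> g) :=
  [/\ basis_of {:g} [tuple e a | a < n + n],
      (forall a b, ip (e a) (e b) = (a == b)%:R) &
      (forall i : 'I_n, J (e (lshift n i)) = e (rshift n i))].

Definition coef (ip : {dot g for @idfun R}) (n : nat) (e : 'I_(n + n) -> g)
    (f : {bilinear g -> g -> g}) (c a b : 'I_(n + n)) : R :=
  ip (f (e a) (e b)) (e c).

Definition form11 (J : {linear g -> g}) (alpha : {bilinear g -> g -> g}) :=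
  alternating alpha /\ (forall X Y, alpha (J X) (J Y) = alpha X Y).

Definition fundamental_form (ip : {dot g for @idfun R}) (J : {linear g -> g})
    (X Y : g) : R :=
  ip (J X) Y.

(* Exterior derivative of a left-invariant 2-form, evaluated on left-invariant
   vector fields: the terms [X (eta (Y, Z))] vanish. *)
Definition ext_d (br : {bilinear g -> g -> g}) (eta : g -> g -> R)
    (X Y Z : g) : R :=
  - eta (br X Y) Z - eta (br Y Z) X - eta (br Z X) Y.

(* The (2,1)+(1,2)-part of a real 3-form. *)
Definition plus_part (J : {linear g -> g}) (eta : g -> g -> g -> R)
    (X Y Z : g) : R :=
  4^-1 * (3 * eta X Y Z + eta (J X) (J Y) Z + eta (J X) Y (J Z)
          + eta X (J Y) (J Z)).

Definition nijenhuis (br : {bilinear g -> g -> g}) (J : {linear g -> g})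
    (X Y : g) : g :=
  J (br (J X) Y) + J (br X (J Y)) + br X Y - br (J X) (J Y).

Definition cyclic_sum (ip : {dot g for @idfun R})
    (alpha : {bilinear g -> g -> g}) (X Y Z : g) : R :=
  ip (alpha X Y) Z + ip (alpha Y Z) X + ip (alpha Z X) Y.

Definition torsion (br nabla : {bilinear g -> g -> g}) (X Y : g) : g :=
  nabla X Y - nabla Y X - br X Y.

(* Since [ip] is constant on left-invariant fields, [nabla ip = 0] has no
   derivative term. *)
Definition metric_compatible (ip : {dot g for @idfun R})
    (nabla : {bilinear g -> g -> g}) :=
  forall X Y Z, ip (nabla X Y) Z + ip Y (nabla X Z) = 0.

Definition preserves_J (J : {linear g -> g})
    (nabla : {bilinear g -> g -> g}) :=
  forall X Y, nabla X (J Y) = J (nabla X Y).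

Definition hermitian_torsion (br : {bilinear g -> g -> g})
    (ip : {dot g for @idfun R}) (J : {linear g -> g})
    (alpha : {bilinear g -> g -> g}) (X Y Z : g) : R :=
  let dw_plus := plus_part J (ext_d br (fundamental_form ip J)) in
  - 4^-1 * ip (nijenhuis br J X Y) Z
  - 2^-1 * dw_plus (J X) (J Y) (J Z)
  + 2^-1 * dw_plus X Y (J Z)
  + 2^-1 * cyclic_sum ip alpha X Y Z
  - 2^-1 * cyclic_sum ip alpha (J X) (J Y) Z
  + ip (alpha X Y) Z.

Definition hermitian_connection_of (br : {bilinear g -> g -> g})
    (ip : {dot g for @idfun R}) (J : {linear g -> g})
    (alpha nabla : {bilinear g -> g -> g}) :=
  metric_compatible ip nabla /\
  (forall X Y Z,
     ip (torsion br nabla X Y) Z = hermitian_torsion br ip J alpha X Y Z).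

(* [hermitian_connection_of br ip J alpha] determines its connection uniquely,
   and that connection exists and is Hermitian: see the lemmas ending this file.
   Below, [c X Y Z] stands for [ip (br X Y) Z], [a X Y Z] for
   [ip (alpha X Y) Z] and [T] for [hermitian_torsion br ip J alpha]. *)

Section KoszulAlgebra.

Variables (J : {linear g -> g}) (c a T : g -> g -> g -> R).
Hypothesis JJ : forall X, J (J X) = - X.
Hypothesis cC : forall X Y Z, c X Y Z = - c Y X Z.
Hypothesis aC : forall X Y Z, a X Y Z = - a Y X Z.
Hypothesis aJl : forall X Y Z, a (J X) Y Z = - a X (J Y) Z.
Hypothesis cP2 : forall k X Y U V,
  c U (k *: X + Y) V = k * c U X V + c U Y V.
Hypothesis cP3 : forall k X Y U V,
  c U V (k *: X + Y) = k * c U V X + c U V Y.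
Hypothesis aP2 : forall k X Y U V,
  a U (k *: X + Y) V = k * a U X V + a U Y V.
Hypothesis aP3 : forall k X Y U V,
  a U V (k *: X + Y) = k * a U V X + a U V Y.
Hypothesis TE : forall X Y Z, T X Y Z =
  - 4^-1 * (- c (J X) Y (J Z) - c X (J Y) (J Z) + c X Y Z - c (J X) (J Y) Z)
  - 2^-1 * plus_part J (fun X Y Z => c X Y (J Z) + c Y Z (J X) + c Z X (J Y))
             (J X) (J Y) (J Z)
  + 2^-1 * plus_part J (fun X Y Z => c X Y (J Z) + c Y Z (J X) + c Z X (J Y))
             X Y (J Z)
  + 2^-1 * (a X Y Z + a Y Z X + a Z X Y)
  - 2^-1 * (a (J X) (J Y) Z + a (J Y) Z (J X) + a Z (J X) (J Y)) + a X Y Z.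

Let cP1 k X Y U V : c (k *: X + Y) U V = k * c X U V + c Y U V.
Proof. by rewrite cC cP2 (cC U X) (cC U Y) mulrN -opprD opprK. Qed.

Let aP1 k X Y U V : a (k *: X + Y) U V = k * a X U V + a Y U V.
Proof. by rewrite aC aP2 (aC U X) (aC U Y) mulrN -opprD opprK. Qed.

Let JN X : J (- X) = - J X. Proof. exact: linearN. Qed.

Let cN2 X Y Z : c X (- Y) Z = - c X Y Z.
Proof.
have c0 : c X 0 Z = 0 by have := cP2 1 0 0 X Z; rewrite scaler0 addr0; lra.
by have := cP2 (-1) Y 0 X Z; rewrite scaleN1r !addr0 c0 addr0 mulN1r.
Qed.

Let cN3 X Y Z : c X Y (- Z) = - c X Y Z.
Proof.
have c0 : c X Y 0 = 0 by have := cP3 1 0 0 X Y; rewrite scaler0 addr0; lra.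
by have := cP3 (-1) Z 0 X Y; rewrite scaleN1r !addr0 c0 addr0 mulN1r.
Qed.

Let cN1 X Y Z : c (- X) Y Z = - c X Y Z.
Proof. by rewrite cC cN2 -cC. Qed.

Let aN2 X Y Z : a X (- Y) Z = - a X Y Z.
Proof.
have a0 : a X 0 Z = 0 by have := aP2 1 0 0 X Z; rewrite scaler0 addr0; lra.
by have := aP2 (-1) Y 0 X Z; rewrite scaleN1r !addr0 a0 addr0 mulN1r.
Qed.

Let aN3 X Y Z : a X Y (- Z) = - a X Y Z.
Proof.
have a0 : a X Y 0 = 0 by have := aP3 1 0 0 X Y; rewrite scaler0 addr0; lra.
by have := aP3 (-1) Z 0 X Y; rewrite scaleN1r !addr0 a0 addr0 mulN1r.
Qed.

Let aN1 X Y Z : a (- X) Y Z = - a X Y Z.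
Proof. by rewrite aC aN2 -aC. Qed.

Let aJr X Y Z : a X (J Y) Z = a Y (J X) Z.
Proof. by rewrite aC aJl opprK. Qed.

Let JE := (JJ, JN, cN1, cN2, cN3, aN1, aN2, aN3, aJl).

Let T_expand X Y Z : T X Y Z =
  a X Y Z
  + 2^-1 * (a Y Z X - a X Z Y + a Y (J Z) (J X) - a X (J Z) (J Y))
  + 2^-1 * (c (J X) (J Y) Z - c X Y Z)
  + 4^-1 * (c Y Z X - c X Z Y + c Y (J Z) (J X) - c X (J Z) (J Y)
            + c (J X) Z (J Y) - c (J Y) Z (J X)
            + c (J Y) (J Z) X - c (J X) (J Z) Y).
Proof.
rewrite TE /plus_part !JE.
rewrite ?(cC Y X) ?(cC Z X) ?(cC Z Y) ?(cC (J Y) X) ?(cC (J Z) X) ?(cC (J Z) Y).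
rewrite ?(cC (J X) Y) ?(cC (J X) Z) ?(cC (J Y) Z).
rewrite ?(cC (J Y) (J X)) ?(cC (J Z) (J X)) ?(cC (J Z) (J Y)).
rewrite ?(aC Y X) ?(aC Z X) ?(aC Z Y) ?(aJr Y X) ?(aJr Z X) ?(aJr Z Y).
lra.
Qed.

Let T_skew X Y Z : T X Y Z = - T Y X Z.
Proof.
rewrite !T_expand (cC Y X) (cC (J Y) (J X)) (aC Y X).
lra.
Qed.

Definition koszul_form X Y Z : R :=
  2^-1 * (c X Y Z - c Y Z X + c Z X Y + T X Y Z - T Y Z X + T Z X Y).

Lemma koszul_metric X Y Z : koszul_form X Y Z + koszul_form X Z Y = 0.
Proof.
rewrite /koszul_form (cC X Z) (cC Z Y) (cC Y X).
rewrite (T_skew X Z) (T_skew Z Y) (T_skew Y X).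
lra.
Qed.

Lemma koszul_torsion X Y Z :
  koszul_form X Y Z - koszul_form Y X Z - c X Y Z = T X Y Z.
Proof.
rewrite /koszul_form (cC Y X) (cC X Z) (cC Z Y).
rewrite (T_skew Y X) (T_skew X Z) (T_skew Z Y).
lra.
Qed.

Lemma koszul_J X Y Z : koszul_form X (J Y) Z + koszul_form X Y (J Z) = 0.
Proof.
rewrite /koszul_form !T_expand !JE.
rewrite ?(cC Y X) ?(cC Z X) ?(cC Z Y) ?(cC (J Y) X) ?(cC (J Z) X) ?(cC (J Z) Y).
rewrite ?(cC (J X) Y) ?(cC (J X) Z) ?(cC (J Y) Z).
rewrite ?(cC (J Y) (J X)) ?(cC (J Z) (J X)) ?(cC (J Z) (J Y)).
rewrite ?(aC Y X) ?(aC Z X) ?(aC Z Y) ?(aJr Y X) ?(aJr Z X) ?(aJr Z Y).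
lra.
Qed.

Let JP k X Y : J (k *: X + Y) = k *: J X + J Y. Proof. exact: linearP. Qed.

Let PE := (JP, cP1, cP2, cP3, aP1, aP2, aP3).

Let TP1 k X Y U V : T (k *: X + Y) U V = k * T X U V + T Y U V.
Proof. rewrite !T_expand !PE; ring. Qed.

Let TP2 k X Y U V : T U (k *: X + Y) V = k * T U X V + T U Y V.
Proof. rewrite !T_expand !PE; ring. Qed.

Let TP3 k X Y U V : T U V (k *: X + Y) = k * T U V X + T U V Y.
Proof. rewrite !T_expand !PE; ring. Qed.

Lemma koszulP1 k X Y U V :
  koszul_form (k *: X + Y) U V = k * koszul_form X U V + koszul_form Y U V.
Proof. rewrite /koszul_form !PE !TP1 !TP2 !TP3; ring. Qed.

Lemma koszulP2 k X Y U V :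
  koszul_form U (k *: X + Y) V = k * koszul_form U X V + koszul_form U Y V.
Proof. rewrite /koszul_form !PE !TP1 !TP2 !TP3; ring. Qed.

Lemma koszulP3 k X Y U V :
  koszul_form U V (k *: X + Y) = k * koszul_form U V X + koszul_form U V Y.
Proof. rewrite /koszul_form !PE !TP1 !TP2 !TP3; ring. Qed.

End KoszulAlgebra.

Section WellDefined.

Variables (br : {bilinear g -> g -> g}) (ip : {dot g for @idfun R}).
Variables (J : {linear g -> g}) (alpha : {bilinear g -> g -> g}).
Hypotheses (br_lie : lie_bracket br) (ipJ : almost_hermitian ip J).
Hypothesis alpha11 : form11 J alpha.

Let c X Y Z := ip (br X Y) Z.
Let a X Y Z := ip (alpha X Y) Z.
Let T := hermitian_torsion br ip J alpha.

Let ipC X Y : ip X Y = ip Y X.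
Proof. by rewrite hermC /= expr0 mul1r. Qed.

Let ipDl X Y Z : ip (X + Y) Z = ip X Z + ip Y Z.
Proof. exact: (linearDl ip). Qed.

Let ipBl X Y Z : ip (X - Y) Z = ip X Z - ip Y Z.
Proof. exact: (linearBl ip). Qed.

Let ipNl X Y : ip (- X) Y = - ip X Y.
Proof. exact: (linearNl ip). Qed.

Let JJ X : J (J X) = - X. Proof. by case: ipJ. Qed.

Let ipJl X Y : ip (J X) Y = - ip X (J Y).
Proof. by case: ipJ => _ <-; rewrite JJ ipNl. Qed.

Let alternating_skew (f : {bilinear g -> g -> g}) X Y :
  alternating f -> f X Y = - f Y X.
Proof.
move=> f0; apply/eqP; rewrite -addr_eq0; have := f0 (X + Y).
by rewrite linearDl !linearDr !f0 add0r addr0 addrC => ->.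
Qed.

Let cC X Y Z : c X Y Z = - c Y X Z.
Proof. by rewrite /c alternating_skew ?ipNl //; case: br_lie. Qed.

Let aC X Y Z : a X Y Z = - a Y X Z.
Proof. by rewrite /a alternating_skew ?ipNl //; case: alpha11. Qed.

Let aJl X Y Z : a (J X) Y Z = - a X (J Y) Z.
Proof.
case: alpha11 => _ aJJ; rewrite /a -[alpha X _]aJJ JJ -ipNl.
by rewrite (linearNr alpha) opprK.
Qed.

Let dw X Y Z := c X Y (J Z) + c Y Z (J X) + c Z X (J Y).

Let TE X Y Z : T X Y Z =
  - 4^-1 * (- c (J X) Y (J Z) - c X (J Y) (J Z) + c X Y Z - c (J X) (J Y) Z)
  - 2^-1 * plus_part J dw (J X) (J Y) (J Z) + 2^-1 * plus_part J dw X Y (J Z)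
  + 2^-1 * (a X Y Z + a Y Z X + a Z X Y)
  - 2^-1 * (a (J X) (J Y) Z + a (J Y) Z (J X) + a Z (J X) (J Y)) + a X Y Z.
Proof.
rewrite /T /hermitian_torsion /cyclic_sum /plus_part /ext_d.
by rewrite /fundamental_form /nijenhuis ipBl !ipDl !ipJl !opprK.
Qed.

Let cP2 k X Y U V : c U (k *: X + Y) V = k * c U X V + c U Y V.
Proof. by rewrite /c (linearPr br); exact: (linearPl ip). Qed.

Let cP3 k X Y U V : c U V (k *: X + Y) = k * c U V X + c U V Y.
Proof. exact: (linearPr ip). Qed.

Let aP2 k X Y U V : a U (k *: X + Y) V = k * a U X V + a U Y V.
Proof. by rewrite /a (linearPr alpha); exact: (linearPl ip). Qed.

Let aP3 k X Y U V : a U V (k *: X + Y) = k * a U V X + a U V Y.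
Proof. exact: (linearPr ip). Qed.

Let K := koszul_form c T.

Let KM X Y Z : K X Y Z + K X Z Y = 0.
Proof. exact: (@koszul_metric J c a T JJ cC aC aJl cP2 cP3 aP2 TE). Qed.

Let KT X Y Z : K X Y Z - K Y X Z - c X Y Z = T X Y Z.
Proof. exact: (@koszul_torsion J c a T JJ cC aC aJl cP2 cP3 aP2 TE). Qed.

Let KJ X Y Z : K X (J Y) Z + K X Y (J Z) = 0.
Proof. exact: (@koszul_J J c a T JJ cC aC aJl cP2 cP3 aP2 aP3 TE). Qed.

Let KL1 k X Y U V : K (k *: X + Y) U V = k * K X U V + K Y U V.
Proof. exact: (@koszulP1 J c a T JJ cC aC aJl cP2 cP3 aP2 aP3 TE). Qed.

Let KL2 k X Y U V : K U (k *: X + Y) V = k * K U X V + K U Y V.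
Proof. exact: (@koszulP2 J c a T JJ cC aC aJl cP2 cP3 aP2 aP3 TE). Qed.

Let KL3 k X Y U V : K U V (k *: X + Y) = k * K U V X + K U V Y.
Proof. exact: (@koszulP3 J c a T JJ cC aC aJl cP2 cP3 aP2 aP3 TE). Qed.

Let ip_inj (X Y : g) : (forall Z, ip X Z = ip Y Z) -> X = Y.
Proof.
move=> h; apply/eqP; rewrite -subr_eq0.
apply: contraT => /(@neq0_dnorm_gt0 _ _ _ ip).
by rewrite ipBl h subrr Order.POrderTheory.ltxx.
Qed.

Let koszul nabla : hermitian_connection_of br ip J alpha nabla ->
  forall X Y Z, ip (nabla X Y) Z = K X Y Z.
Proof.
case=> nm nt X Y Z; rewrite /K /koszul_form /T -!nt /torsion !ipBl /c.
have := (nm X Y Z, nm Y Z X, nm Z X Y) => -[[]].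
rewrite (ipC Y) (ipC Z (nabla Y X)) (ipC X (nabla Z Y)).
lra.
Qed.

Lemma hermitian_connection_unique (nabla1 nabla2 : {bilinear g -> g -> g}) :
  hermitian_connection_of br ip J alpha nabla1 ->
  hermitian_connection_of br ip J alpha nabla2 ->
  forall X Y, nabla1 X Y = nabla2 X Y.
Proof.
by move=> h1 h2 X Y; apply: ip_inj => Z; rewrite (koszul h1) (koszul h2).
Qed.

Lemma hermitian_connection_preserves_J (nabla : {bilinear g -> g -> g}) :
  hermitian_connection_of br ip J alpha nabla -> preserves_J J nabla.
Proof.
move=> h X Y; apply: ip_inj => Z; rewrite ipJl !(koszul h).
by apply/eqP; rewrite -addr_eq0 KJ.
Qed.

Lemma hermitian_connection_exists n (e : 'I_(n + n) -> g) :
  standard_frame ip J e ->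
  exists nabla, hermitian_connection_of br ip J alpha nabla.
Proof.
case=> e_basis e_on _; pose D X Y := \sum_b K X Y (e b) *: e b.
have Dl Y : linear (D^~ Y).
  move=> k U V; rewrite /D scaler_sumr -big_split; apply: eq_bigr => b _ /=.
  by rewrite KL1 scalerDl scalerA.
have Dr X : linear (D X).
  move=> k U V; rewrite /D scaler_sumr -big_split; apply: eq_bigr => b _ /=.
  by rewrite KL2 scalerDl scalerA.
pose Dm := bilinear_isBilinear.Build R g g g *:%R *:%R D (Dl, Dr).
pose nabla : {bilinear g -> g -> g} := HB.pack D Dm.
have nE X Y Z : ip (nabla X Y) Z = K X Y Z.
  have Klin : linear_for *%R (K X Y) by move=> k U V; rewrite KL3.
  pose KXY : {linear g -> R^o} := HB.pack (K X Y : g -> R^o)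
    (GRing.isLinear.Build R g R^o _ (K X Y : g -> R^o) Klin).
  have nb b : ip (nabla X Y) (e b) = K X Y (e b).
    transitivity (\sum_d K X Y (e d) * ip (e d) (e b)).
      rewrite /nabla /= /D (linear_sumlz ip).
      by apply: eq_bigr => d _; exact: (linearZl_LR ip).
    rewrite (bigD1 b) //= e_on eqxx mulr1 big1 ?addr0 // => d d_neq_b.
    by rewrite e_on (negbTE d_neq_b) mulr0.
  have -> : K X Y Z = KXY Z by [].
  rewrite (coord_basis e_basis (memvf Z)) (linear_sumr ip) linear_sum.
  apply: eq_bigr => b _; rewrite -tnth_nth tnth_mktuple [RHS]linearZ -[KXY _]nb.
  exact: (linearZr_LR ip).
exists nabla; split=> [X Y Z|X Y Z].
  by rewrite (ipC Y) !nE KM.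
by rewrite /torsion !ipBl !nE KT.
Qed.

End WellDefined.

End LeftInvariantGeometry.

(* Main.v *)
Require Import Defs.
From mathcomp Require Import all_boot all_order all_algebra.
From mathcomp Require Import reals.
From mathcomp Require Import lra.

(** The torsion of the connection attached to [alpha] is given by a
    coordinate-free formula, so each of the six identities only evaluates that
    formula on frame vectors.  The point is to bring the formula to a form in
    which evaluation is mechanical.  Since [J] is skew-adjoint, every [J] that
    acts on a bracket, in the Nijenhuis tensor or in [d omega], can be moved to
    the other slot of the inner product; it then acts only on [X], [Y] and [Z],
    and the contributions of the Nijenhuis tensor and of [(d omega)^+] that
    have the same shape combine.  Since [alpha] has type (1,1), the terms
    [alpha (X, Y)] and [alpha (J X, J Y)] of the two cyclic sums cancel.  What
    remains is [hermitian_torsionE].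

    On a standard frame [J e_i = e_(n+i)] and [J e_(n+i) = - e_i], so every
    term of [hermitian_torsionE] becomes, up to sign, one structure constant or
    one component of [alpha].  The identities then hold up to the
    skew-symmetry of [C^c_ab] and [alpha^c_ab] in [a, b] and the invariance of
    [alpha^c_ab] when [J] is applied to both [e_a] and [e_b]. *)

Set Implicit Arguments.
Unset Strict Implicit.
Unset Printing Implicit Defensive.

Import GRing.Theory Num.Theory.
Local Open Scope ring_scope.

Section TorsionFormula.

Context {R : realType} {g : vectType R}.

Implicit Types (f alpha br : {bilinear g -> g -> g}) (X Y Z : g).
Implicit Types (ip : {dot g for @idfun R}) (J : {linear g -> g}).

Lemma dotNl ip X Y : ip (- X) Y = - ip X Y.
Proof. exact: (linearNl ip). Qed.

Lemma dotNr ip X Y : ip X (- Y) = - ip X Y.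
Proof. exact: (linearNr ip). Qed.

Lemma dotDl ip X Y Z : ip (X + Y) Z = ip X Z + ip Y Z.
Proof. exact: (linearDl ip). Qed.

Lemma bilinearNl f X Y : f (- X) Y = - f X Y.
Proof. exact: (linearNl f). Qed.

Lemma bilinearNr f X Y : f X (- Y) = - f X Y.
Proof. exact: (linearNr f). Qed.

Lemma alternating_skew f X Y : alternating f -> f X Y = - f Y X.
Proof.
move=> f0; apply/eqP; rewrite -addr_eq0; have := f0 (X + Y).
by rewrite linearDl !linearDr !f0 add0r addr0 addrC => ->.
Qed.

Lemma almost_hermitian_skew_adjoint ip J X Y :
  almost_hermitian ip J -> ip (J X) Y = - ip X (J Y).
Proof. by case=> JJ ipJJ; rewrite -[LHS]ipJJ JJ dotNl. Qed.

Lemma form11_Jl J alpha X Y :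
  (forall U, J (J U) = - U) -> form11 J alpha ->
  alpha (J X) Y = - alpha X (J Y).
Proof. by move=> JJ [_ aJJ]; rewrite -[LHS]aJJ JJ bilinearNl. Qed.

(** The terms of the right-hand side in [c] are what the Nijenhuis tensor and
    [(d omega)^+] leave together: [Z] is in the metric slot of the first two,
    and [X], [Y] or their images by [J] are in that of the others.  The
    Nijenhuis terms [c (J X) Y (J Z)] and [c X (J Y) (J Z)] are absent because
    they cancel against the same terms of [(d omega)^+]. *)
Lemma hermitian_torsionE br ip J alpha X Y Z :
    almost_hermitian ip J -> form11 J alpha ->
  let c U V W := ip (br U V) W in
  let a U V W := ip (alpha U V) W in
  hermitian_torsion br ip J alpha X Y Z =
  2^-1 * (c (J X) (J Y) Z - c X Y Z)
  + 4^-1 * (c Y Z X + c Y (J Z) (J X) - c (J Y) Z (J X) + c (J Y) (J Z) X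
            + c Z X Y + c (J Z) X (J Y) - c Z (J X) (J Y) + c (J Z) (J X) Y)
  + a X Y Z
  + 2^-1 * (a Y Z X + a Z X Y - a (J Y) Z (J X) - a Z (J X) (J Y)).
Proof.
move=> ipJ alpha11 c a.
have JJ U : J (J U) = - U by case: ipJ.
have aJJ U V W : a (J U) (J V) W = a U V W by rewrite /a alpha11.2.
rewrite /hermitian_torsion /cyclic_sum /plus_part /ext_d /fundamental_form.
rewrite /nijenhuis !dotDl.
rewrite !(dotNl, JJ, linearN, bilinearNl, bilinearNr, dotNr,
          almost_hermitian_skew_adjoint _ _ ipJ, opprK).
rewrite -!/(c _ _ _) -!/(a _ _ _) aJJ.
lra.
Qed.

End TorsionFormula.

Theorem proposition3p19 (R : realType) (n : nat) (g : vectType R)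
    (dim_g : \dim {:g} = (2 * n)%N)
    (br : {bilinear g -> g -> g}) (br_lie : lie_bracket br)
    (ip : {dot g for @idfun R}) (J : {linear g -> g})
    (ipJ : almost_hermitian ip J)
    (e : 'I_(n + n) -> g) (e_std : standard_frame ip J e)
    (alpha : {bilinear g -> g -> g}) (alpha11 : form11 J alpha)
    (nabla : {bilinear g -> g -> g})
    (nabla_alpha : hermitian_connection_of br ip J alpha nabla)
    (i0 j0 k0 : 'I_n) :
  let C := coef ip e br in
  let A := coef ip e alpha in
  let T := torsion br nabla in
  let i := lshift n i0 in let ni := rshift n i0 in
  let j := lshift n j0 in let nj := rshift n j0 in
  let k := lshift n k0 in let nk := rshift n k0 in
  (ip (T (e i) (e j)) (e k) =
      - 2^-1 * C k i j - 4^-1 * C j i k + 4^-1 * C i j k + 2^-1 * C k ni nj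
      + 4^-1 * C i nj nk + 4^-1 * C j nk ni + 4^-1 * C ni j nk
      + 4^-1 * C nj nk i + 4^-1 * C ni k nj - 4^-1 * C nj k ni + A k i j
      + 2^-1 * A i j k + 2^-1 * A j k i - 2^-1 * A ni nj k - 2^-1 * A nj k ni) /\
  (ip (T (e i) (e j)) (e nk) =
      - 2^-1 * C nk i j + 2^-1 * C nk ni nj - 4^-1 * C j k ni
      - 4^-1 * C i nj k - 4^-1 * C j i nk + 4^-1 * C ni nk nj
      + 4^-1 * C i j nk - 4^-1 * C nj nk ni - 4^-1 * C nj k i
      - 4^-1 * C ni j k + A nk i j + 2^-1 * A i j nk + 2^-1 * A j nk i
      - 2^-1 * A ni nj nk - 2^-1 * A nj nk ni) /\
  (ip (T (e i) (e nj)) (e k) =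
      - 2^-1 * C k ni j - 2^-1 * C k i nj - 4^-1 * C nj ni nk
      + 4^-1 * C i nk j + 4^-1 * C ni nj nk - 4^-1 * C j nk i
      - 4^-1 * C i k nj - 4^-1 * C j ni k - 4^-1 * C nj i k - 4^-1 * C ni k j
      + A k i nj + 2^-1 * A i nj k + 2^-1 * A nj k i + 2^-1 * A ni j k
      + 2^-1 * A j k ni) /\
  (ip (T (e i) (e nj)) (e nk) =
      - 2^-1 * C nk ni j - 2^-1 * C nk i nj + 4^-1 * C i j k
      - 4^-1 * C nj k ni + 4^-1 * C i nj nk + 4^-1 * C j nk ni
      + 4^-1 * C j k i - 4^-1 * C ni nj k - 4^-1 * C nj i nk
      - 4^-1 * C ni nk j + A nk i nj + 2^-1 * A i nj nk + 2^-1 * A nj nk i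
      + 2^-1 * A ni j nk + 2^-1 * A j nk ni) /\
  (ip (T (e ni) (e nj)) (e k) =
      - 2^-1 * C k ni nj + 2^-1 * C k i j - 4^-1 * C i nj nk
      - 4^-1 * C j nk ni - 4^-1 * C ni j nk - 4^-1 * C nj nk i
      - 4^-1 * C ni k nj + 4^-1 * C j i k + 4^-1 * C i k j + 4^-1 * C nj k ni
      + A k ni nj + 2^-1 * A j ni nk + 2^-1 * A ni nk j + 2^-1 * A nj i nk
      + 2^-1 * A i nk nj) /\
  (ip (T (e ni) (e nj)) (e nk) =
      - 2^-1 * C nk ni nj + 2^-1 * C nk i j + 4^-1 * C i nj k
      + 4^-1 * C j k ni + 4^-1 * C ni j k + 4^-1 * C nj k i
      + 4^-1 * C ni nj nk - 4^-1 * C j nk i - 4^-1 * C i j nk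
      + 4^-1 * C nj nk ni + A nk ni nj + 2^-1 * A ni nj nk + 2^-1 * A nj nk ni
      - 2^-1 * A i j nk - 2^-1 * A j nk i).
Proof.
move=> C A T i ni j nj k nk.
have JJ U : J (J U) = - U by case: ipJ.
have Je (p : 'I_n) : J (e (lshift n p)) = e (rshift n p) by case: e_std.
have Jne (p : 'I_n) : J (e (rshift n p)) = - e (lshift n p) by rewrite -Je JJ.
have TE X Y Z := hermitian_torsionE br X Y Z ipJ alpha11.
have CC p q r : C p q r = - C p r q.
  by rewrite /C /coef (alternating_skew _ _ br_lie.1) dotNl.
have AC p q r : A p q r = - A p r q.
  by rewrite /A /coef (alternating_skew _ _ alpha11.1) dotNl.
have AJ (p q : 'I_n) r :
    A r (rshift n p) (lshift n q) = - A r (lshift n p) (rshift n q).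
  by rewrite /A /coef -Je (form11_Jl _ _ JJ alpha11) Je dotNl.
have AJJ (p q : 'I_n) r :
    A r (rshift n p) (rshift n q) = A r (lshift n p) (lshift n q).
  by rewrite /A /coef -!Je alpha11.2.
have AJC (p q : 'I_n) r :
    A r (lshift n p) (rshift n q) = A r (lshift n q) (rshift n p).
  by rewrite AC AJ opprK.
repeat split; rewrite nabla_alpha.2 TE !(Je, Jne)
  ?(dotNl, dotNr, bilinearNl, bilinearNr, opprK);
  rewrite -?[ip (br (e _) (e _)) (e _)]/(C _ _ _);
  rewrite -?[ip (alpha (e _) (e _)) (e _)]/(A _ _ _).
(* Linear arithmetic treats the components as unrelated unknowns, so those
   that agree up to sign are reduced to a common one: lower indices are ordered
   by [i], [j], [k], and the first lower index of [A] is never shifted. *)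
all: rewrite ?(CC _ j i) ?(CC _ k i) ?(CC _ k j).
all: rewrite ?(CC _ nj i) ?(CC _ nk i) ?(CC _ ni j).
all: rewrite ?(CC _ nk j) ?(CC _ ni k) ?(CC _ nj k).
all: rewrite ?(CC _ nj ni) ?(CC _ nk ni) ?(CC _ nk nj).
all: rewrite ?AJ ?AJJ ?(AJC j0 i0) ?(AJC k0 i0) ?(AJC k0 j0).
all: rewrite ?(AC _ j i) ?(AC _ k i) ?(AC _ k j).
all: lra.
Qed.
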